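(* Let $w_1,w_2,w_3$ be positive integers, $n\ge0$ an integer, and $y_1\in\mathbb{Z}_p$. Then \begin{align*} &\sum_{k+l+m=n}\binom{n}{k,l,m}B_{k,q^{w_2w_3}}(w_1y_1)S_{l,q^{w_1w_3}}(w_2-1)S_{m,q^{w_1w_2}}(w_3-1)\,w_1^{l+m}w_2^{k+m-1}w_3^{k+l-1}\\ &=\sum_{k+l+m=n}\binom{n}{k,l,m}B_{k,q^{w_1w_3}}(w_2y_1)S_{l,q^{w_1w_2}}(w_3-1)S_{m,q^{w_2w_3}}(w_1-1)\,w_2^{l+m}w_3^{k+m-1}w_1^{k+l-1}\\ &=\sum_{k+l+m=n}\binom{n}{k,l,m}B_{k,q^{w_1w_2}}(w_3y_1)S_{l,q^{w_2w_3}}(w_1-1)S_{m,q^{w_1w_3}}(w_2-1)\,w_3^{l+m}w_1^{k+m-1}w_2^{k+l-1}. \end{align*}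
   Context: Let $p$ be a prime, $\mathbb{C}_p$ the completion of an algebraic closure of $\mathbb{Q}_p$, and $|\cdot|_p$ the absolute value on $\mathbb{C}_p$ with $|p|_p=1/p$. Fix $q\in\mathbb{C}_p$ with $q\neq 1$ and $|q-1|_p<p^{-1/(p-1)}$; for every positive integer $w$, $Q=q^w$ also satisfies these conditions. For such $Q$, the $Q$-Bernoulli numbers are defined by $\frac{\log Q+t}{Qe^t-1}=\sum_{n\ge0}B_{n,Q}\frac{t^n}{n!}$ ($\log$ the $p$-adic logarithm), and the $Q$-Bernoulli polynomials by $\frac{\log Q+t}{Qe^t-1}e^{xt}=\sum_{n\ge0}B_{n,Q}(x)\frac{t^n}{n!}$, i.e. $B_{n,Q}(x)=\sum_{j=0}^n\binom{n}{j}B_{j,Q}x^{n-j}$. For integers $k\ge0$, $N\ge0$, $S_{k,Q}(N)=\sum_{i=0}^N i^kQ^i$, with $0^0=1$. The sum $\sum_{k+l+m=n}$ runs over nonnegative integers $k,l,m$ with $k+l+m=n$, and $\binom{n}{k,l,m}=\frac{n!}{k!\,l!\,m!}$. *)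

(* Defs.v *)
From HB Require Import structures.
From mathcomp Require Import all_boot all_order all_algebra.
From mathcomp Require Import all_classical all_reals all_analysis.

Set Implicit Arguments.
Unset Strict Implicit.
Unset Printing Implicit Defensive.

Import Order.TTheory GRing.Theory Num.Theory.
Import numFieldNormedType.Exports.

Local Open Scope classical_set_scope.
Local Open Scope ring_scope.

Section ValuedFields.
Variable R : realType.

Record nonarch_abs (K : fieldType) (v : K -> R) : Prop := NonarchAbs {
  nonarch_abs_ge0 : forall x, 0 <= v x;
  nonarch_abs_eq0 : forall x, v x = 0 <-> x = 0;
  nonarch_absM : forall x y, v (x * y) = v x * v y;
  nonarch_absD : forall x y, v (x + y) <= Num.max (v x) (v y)
}.

Definition vcvg (K : fieldType) (v : K -> R) (u : nat -> K) (l : K) : Prop :=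
  (fun n => v (u n - l)) @ \oo --> (0 : R).

Definition vcauchy (K : fieldType) (v : K -> R) (u : nat -> K) : Prop :=
  forall e : R, 0 < e ->
  exists N, forall m n, (N <= m)%N -> (N <= n)%N -> v (u m - u n) < e.

Definition vcomplete (K : fieldType) (v : K -> R) : Prop :=
  forall u, vcauchy v u -> exists l, vcvg v u l.

Record is_completion (K L : fieldType) (vK : K -> R) (vL : L -> R)
    (f : {rmorphism K -> L}) : Prop := IsCompletion {
  completion_abs : nonarch_abs vL;
  completion_isometry : forall x, vL (f x) = vK x;
  completion_dense : forall (x : L) (e : R), 0 < e ->
    exists y : K, vL (x - f y) < e;
  completion_complete : vcomplete vL
}.

Record is_algebraic_closure (K L : fieldType) (f : {rmorphism K -> L})
    : Prop := IsAlgebraicClosure {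
  algebraic_closure_closed : GRing.closed_field_axiom L;
  algebraic_closure_algebraic : forall x : L, algebraicOver f x
}.

Definition padic_abs (p : nat) (x : rat) : R :=
  if x == 0 then 0
  else p%:R ^ ((logn p `|denq x|%N)%:Z - (logn p `|numq x|%N)%:Z).

(* Q_p, its algebraic closure and C_p are only determined up to isometric
   isomorphism; an element of [padicComplex p] is any choice of the tower
   Q -> Q_p -> Q_p^alg -> C_p with the absolute values extending that of Q
   (so that |p|_p = 1/p). *)
Record padicComplex (p : nat) := PadicComplex {
  Qp : fieldType;
  absQp : Qp -> R;
  rat_to_Qp : {rmorphism rat -> Qp};
  Qp_completion : is_completion (padic_abs p) absQp rat_to_Qp;
  Qpbar : fieldType;
  absQpbar : Qpbar -> R;
  Qp_to_Qpbar : {rmorphism Qp -> Qpbar};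
  Qpbar_closure : is_algebraic_closure Qp_to_Qpbar;
  Qpbar_abs : nonarch_abs absQpbar;
  Qpbar_abs_extends : forall x, absQpbar (Qp_to_Qpbar x) = absQp x;
  Cp :> fieldType;
  absCp : Cp -> R;
  Qpbar_to_Cp : {rmorphism Qpbar -> Cp};
  Cp_completion : is_completion absQpbar absCp Qpbar_to_Cp
}.

Definition Qp_to_Cp (p : nat) (C : padicComplex p) (x : Qp C) : C :=
  Qpbar_to_Cp C (Qp_to_Qpbar C x).

Definition padicInt (p : nat) (C : padicComplex p) : set (Qp C) :=
  [set x | absQp x <= 1].

(* Value 0 where the series diverges, i.e. for |x - 1|_p >= 1. *)
Definition padic_log (p : nat) (C : padicComplex p) (x : C) : C :=
  xget 0 [set l : Cp C | vcvg (@absCp p C)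
    (fun n => \sum_(1 <= k < n) (-1) ^+ k.+1 * (x - 1) ^+ k / k%:R) l].

End ValuedFields.

Arguments padicInt {R p} C.

(* The formal power series \sum_n f_n t^n is represented by n |-> f_n. *)
Section FormalPowerSeries.
Variable K : fieldType.
Implicit Types (f g : nat -> K) (x : K).

Definition fps_mul f g (n : nat) : K := \sum_(i < n.+1) f i * g (n - i)%N.

Fixpoint fps_inv_seq f (n : nat) : seq K :=
  if n is m.+1 then
    let s := fps_inv_seq f m in
    rcons s (((m == 0)%N%:R - \sum_(i < m) s`_i * f (m - i)%N) / f 0%N)
  else [::].

(* Inverse series; meaningful only if f_0 != 0, see [fps_mulVf]. *)
Definition fps_inv f (n : nat) : K := (fps_inv_seq f n.+1)`_n.

(* e^{xt} *)
Definition fps_exp x (n : nat) : K := x ^+ n / n`!%:R.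

Lemma size_fps_inv_seq f n : size (fps_inv_seq f n) = n.
Proof. by elim: n => //= n IHn; rewrite size_rcons IHn. Qed.

Lemma nth_fps_inv_seq f n i : (i < n)%N -> (fps_inv_seq f n)`_i = fps_inv f i.
Proof.
elim: n => // n IHn; rewrite ltnS leq_eqVlt => /predU1P[-> //|ltin].
by rewrite /= nth_rcons size_fps_inv_seq ltin IHn.
Qed.

Lemma fps_mulVf f n : f 0%N != 0 -> fps_mul (fps_inv f) f n = (n == 0)%N%:R.
Proof.
move=> f0; rewrite /fps_mul big_ord_recr /= subnn {2}/fps_inv /=.
rewrite nth_rcons size_fps_inv_seq ltnn eqxx divfK // addrC.
under [X in _ - X]eq_bigr => i _ do rewrite nth_fps_inv_seq //.
by rewrite subrK.
Qed.

End FormalPowerSeries.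

Section QBernoulli.
Variables (R : realType) (p : nat) (C : padicComplex R p).
Implicit Types Q x : C.

(* (log Q + t) / (Q e^t - 1) *)
Definition qBern_gf Q : nat -> C :=
  fps_mul (fun n => if n is 0%N then padic_log Q else (n == 1)%N%:R)
          (fps_inv (fun n => Q * fps_exp 1 n - (n == 0)%N%:R)).

Definition qBern (n : nat) Q : C := n`!%:R * qBern_gf Q n.

Definition qBern_poly (n : nat) Q x : C :=
  n`!%:R * fps_mul (qBern_gf Q) (fps_exp x) n.

(* S_{k,Q}(N); note 0 ^+ 0 = 1. *)
Definition qpow_sum (k : nat) Q (N : nat) : C :=
  \sum_(i < N.+1) i%:R ^+ k * Q ^+ i.

Definition trinom (n k l m : nat) : C := n`!%:R / (k`! * l`! * m`!)%:R.

Lemma Cp_natr_neq0 n : (0 < n)%N -> (n%:R : C) != 0.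
Proof.
move=> n_gt0.
have -> : (n%:R : C) = Qpbar_to_Cp C (Qp_to_Qpbar C (rat_to_Qp C n%:R)).
  by rewrite !rmorph_nat.
by rewrite !fmorph_eq0 pnatr_eq0 -lt0n.
Qed.

Lemma qBern_polyE n Q x :
  qBern_poly n Q x =
  \sum_(j < n.+1) 'C(n, j)%:R * qBern j Q * x ^+ (n - j)%N.
Proof.
rewrite /qBern_poly /fps_mul big_distrr /=; apply: eq_bigr => j _.
have lejn : (j <= n)%N by rewrite -ltnS.
rewrite -(bin_fact lejn) !natrM /fps_exp /qBern.
set a := _`!%:R; set b := _`!%:R.
have b0 : b != 0 by apply: Cp_natr_neq0; rewrite fact_gt0.
rewrite -!mulrA; congr (_ * (_ * _)); rewrite mulrCA; congr (_ * _).
by rewrite mulrCA divff ?mulr1.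
Qed.

End QBernoulli.

Arguments qBern_poly {R p C} n Q x.
Arguments qpow_sum {R p C} k Q N.
Arguments trinom {R p} C n k l m.

(* Main.v *)
Require Import Defs.
From HB Require Import structures.
From mathcomp Require Import all_boot all_order all_algebra.
From mathcomp Require Import all_classical all_reals all_analysis.
From mathcomp Require Import ring.

Set Implicit Arguments.
Unset Strict Implicit.
Unset Printing Implicit Defensive.

Import Order.TTheory GRing.Theory Num.Theory.

Local Open Scope classical_set_scope.
Local Open Scope ring_scope.

(** Up to the factor n!, T(w1, w2, w3) is the coefficient of t^n in
    [(log q + t) e^(w y t) (q^w e^(wt) - 1)^2] divided by the product of
    [q^a e^(at) - 1] over a = w2 w3, w1 w3, w1 w2, where w = w1 w2 w3: the
    power sums are finite geometric sums in q^b e^(bt).  This is symmetric in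
    the w_i.  The p-adic input is that [log (q^a) = a log q], which follows from
    [log x = lim_N (x^(p^N) - 1) / p^N], and that [q^a != 1], so that the
    constant terms of the denominators do not vanish; the latter holds because
    [|x^k| < |k + 1|] for [|x| < p^(-1/(p-1))] and [k > 0]. *)

(** * Ultrametric absolute values and convergence with respect to them *)

Section NonarchAbs.
Variables (R : realType) (K : fieldType) (v : K -> R).
Hypothesis v_abs : nonarch_abs v.
Implicit Types (x y l : K) (u : nat -> K) (e : R).

Local Lemma v_ge0 x : 0 <= v x. Proof. exact: nonarch_abs_ge0. Qed.
Hint Resolve v_ge0 : core.

Lemma nonarch_abs0 : v 0 = 0.
Proof. exact/(nonarch_abs_eq0 v_abs). Qed.

Lemma nonarch_abs_neq0 x : x != 0 -> v x != 0.
Proof. by apply: contra => /eqP/(nonarch_abs_eq0 v_abs)->. Qed.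

Lemma nonarch_abs_gt0 x : x != 0 -> 0 < v x.
Proof. by move=> x0; rewrite lt0r nonarch_abs_neq0 /=. Qed.

Lemma nonarch_abs1 : v 1 = 1.
Proof.
apply: (mulfI (nonarch_abs_neq0 (oner_neq0 K))).
by rewrite -(nonarch_absM v_abs) !mulr1.
Qed.

Lemma nonarch_absN x : v (- x) = v x.
Proof.
suff vN1 : v (-1) = 1 by rewrite -mulN1r (nonarch_absM v_abs) vN1 mul1r.
apply/eqP; rewrite -(@eqrXn2 _ 2) ?ler01 // expr1n expr2.
by rewrite -(nonarch_absM v_abs) mulrNN mulr1 nonarch_abs1.
Qed.

Lemma nonarch_absX x n : v (x ^+ n) = v x ^+ n.
Proof.
elim: n => [|n IHn]; first by rewrite !expr0 nonarch_abs1.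
by rewrite !exprS (nonarch_absM v_abs) IHn.
Qed.

Lemma nonarch_absV x : v x^-1 = (v x)^-1.
Proof.
have [->|x0] := eqVneq x 0; first by rewrite invr0 nonarch_abs0 invr0.
apply: (mulfI (nonarch_abs_neq0 x0)).
by rewrite -(nonarch_absM v_abs) !divff ?nonarch_abs1 ?nonarch_abs_neq0.
Qed.

Lemma nonarch_absD_le x y e : v x <= e -> v y <= e -> v (x + y) <= e.
Proof.
by move=> xe ye; rewrite (le_trans (nonarch_absD v_abs x y)) // ge_max xe.
Qed.

Lemma nonarch_absD_lt x y e : v x < e -> v y < e -> v (x + y) < e.
Proof.
by move=> xe ye; rewrite (le_lt_trans (nonarch_absD v_abs x y)) // gt_max xe.
Qed.

Lemma nonarch_abs_sum_le I (r : seq I) (P : pred I) (F : I -> K) e :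
  0 <= e -> (forall i, P i -> v (F i) <= e) -> v (\sum_(i <- r | P i) F i) <= e.
Proof.
move=> e0 Fe; apply: (big_ind (fun x => v x <= e)) => //.
  by rewrite nonarch_abs0.
by move=> x y; apply: nonarch_absD_le.
Qed.

Lemma nonarch_abs_sum_lt I (r : seq I) (P : pred I) (F : I -> K) e :
  0 < e -> (forall i, P i -> v (F i) < e) -> v (\sum_(i <- r | P i) F i) < e.
Proof.
move=> e0 Fe; apply: (big_ind (fun x => v x < e)) => //.
  by rewrite nonarch_abs0.
by move=> x y; apply: nonarch_absD_lt.
Qed.

Lemma nonarch_abs_nat n : v n%:R <= 1.
Proof.
elim: n => [|n IHn]; first by rewrite nonarch_abs0 ler01.
by rewrite -natr1 nonarch_absD_le ?nonarch_abs1.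
Qed.

Lemma nonarch_abs_le1 x : v (x - 1) <= 1 -> v x <= 1.
Proof. by move=> x1; rewrite -(subrK 1 x) nonarch_absD_le ?nonarch_abs1. Qed.

Lemma nonarch_absX_sub1 x n : v (x - 1) <= 1 -> v (x ^+ n - 1) <= v (x - 1).
Proof.
move=> x1; rewrite subrX1 (nonarch_absM v_abs) ler_piMr //.
apply: nonarch_abs_sum_le => // i _.
by rewrite nonarch_absX exprn_ile1 // nonarch_abs_le1.
Qed.

Lemma vcvgP u l :
  vcvg v u l <-> forall e, 0 < e ->
    exists N, forall n, (N <= n)%N -> v (u n - l) < e.
Proof.
rewrite /vcvg; split => [/cvgr0Pnorm_lt ul e /ul [N _ uN]|ul].
  by exists N => n /uN; rewrite ger0_norm.
by apply/cvgr0Pnorm_lt => e /ul [N uN]; exists N => // n /= /uN; rewrite ger0_norm.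
Qed.

Lemma vcvg_unique u l l' : vcvg v u l -> vcvg v u l' -> l = l'.
Proof.
move=> /vcvgP ul /vcvgP ul'; apply/eqP; rewrite -subr_eq0; apply/negPn/negP.
move=> /nonarch_abs_gt0 d0; have [[N uN] [N' uN']] := (ul _ d0, ul' _ d0).
have /uN ltl := leq_maxl N N'; have /uN' ltl' := leq_maxr N N'.
have := nonarch_absD_lt (x := u (maxn N N') - l') ltl'.
move=> /(_ (- (u (maxn N N') - l))); rewrite nonarch_absN => /(_ ltl).
by rewrite opprB addrC addrA subrK ltxx.
Qed.

Lemma vcvg_subseq u l (f : nat -> nat) :
  (forall n, (n <= f n)%N) -> vcvg v u l -> vcvg v (u \o f) l.
Proof.
move=> fn /vcvgP ul; apply/vcvgP => e /ul [N uN]; exists N => n Nn.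
by apply: uN; rewrite (leq_trans Nn).
Qed.

Lemma vcvg_sub0 u u' l : vcvg v u l -> vcvg v (fun n => u' n - u n) 0 ->
  vcvg v u' l.
Proof.
move=> /vcvgP ul /vcvgP uu'; apply/vcvgP => e e0.
have [[N uN] [N' uN']] := (ul _ e0, uu' _ e0); exists (maxn N N') => n.
rewrite geq_max => /andP[/uN un /uN' un']; rewrite -(subrKA (u n)).
by apply: nonarch_absD_lt; rewrite // -[u' n - u n]subr0.
Qed.

(** By the ultrametric inequality a block of consecutive terms is no larger than its largest term,
    so terms tending to 0 already make the partial sums Cauchy. *)
Lemma vcomplete_series (c : nat -> K) m :
  vcomplete v -> vcvg v c 0 -> exists l, vcvg v (fun n => \sum_(m <= k < n) c k) l.
Proof.
move=> vcpl /vcvgP c0; apply: vcpl => e e0; have [N cN] := c0 _ e0.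
have mono i j : (maxn m N <= i)%N -> (i <= j)%N ->
    v (\sum_(m <= k < j) c k - \sum_(m <= k < i) c k) < e.
  rewrite geq_max => /andP[mi Ni] ij.
  rewrite (big_cat_nat mi ij) /= addrAC subrr add0r big_nat_cond.
  apply: nonarch_abs_sum_lt => // k /andP[/andP[ik _] _].
  by rewrite -[c k]subr0 cN // (leq_trans Ni).
exists (maxn m N) => i j Ni Nj; case: (leqP i j) => [ij|/ltnW ji].
  by rewrite -opprB nonarch_absN mono.
exact: mono.
Qed.

End NonarchAbs.

(** * Real estimates: geometric decay against linear and quadratic factors *)

Section GeometricDecay.
Variable R : realType.
Implicit Types r e B : R.

Lemma expr_small r B e : 0 <= r < 1 -> 0 < e ->
  exists N, forall n, (N <= n)%N -> r ^+ n * B < e.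
Proof.
move=> /andP[r0 r1] e0; have /cvg_expr : `|r| < 1 by rewrite ger0_norm.
have B1 : 0 < `|B| + 1 by rewrite ltr_pwDr.
move=> /cvgr0Pnorm_lt /(_ (e / (`|B| + 1)) (divr_gt0 e0 B1)) [N _ rN].
exists N => n /rN /=; rewrite ger0_norm ?exprn_ge0 // ltr_pdivlMr //.
apply: le_lt_trans; rewrite ler_wpM2l ?exprn_ge0 //.
by rewrite (le_trans (ler_norm B)) // lerDl.
Qed.

Lemma bernoulli_ineq (h : R) n : 0 <= h -> 1 + n%:R * h <= (1 + h) ^+ n.
Proof.
move=> h0; elim: n => [|n IHn]; first by rewrite mul0r addr0 expr0.
rewrite exprSr (le_trans _ (ler_wpM2r _ IHn)) ?addr_ge0 //.
rewrite -natr1 mulrDl mul1r addrA [leRHS]mulrDr mulr1 lerD2l mulrDl mul1r.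
by rewrite lerDl !mulr_ge0.
Qed.

(** With h = 1/r - 1, Bernoulli's inequality gives n h <= (1 + h)^n = r^(-n), hence n r^n <= 1/h. *)
Lemma mulrn_expr_bounded r : 0 <= r < 1 ->
  exists2 B, 0 <= B & forall n, n%:R * r ^+ n <= B.
Proof.
move=> /andP[]; rewrite le0r => /predU1P[->|r0] r1.
  (* At r = 0 the convention 0^-1 = 0 would make the general witness negative; here n r^n vanishes
     for every n. *)
  by exists 0 => // -[|n]; rewrite ?mul0r // expr0n mulr0.
have h0 : 0 < r^-1 - 1 by rewrite subr_gt0 invf_gt1.
exists (r^-1 - 1)^-1 => [|n]; first by rewrite invr_ge0 ltW.
rewrite -ler_pdivlMr ?exprn_gt0 // ler_pdivlMl // mulrC -exprVn.
have := bernoulli_ineq n (ltW h0); rewrite [1 + (_ - _)]addrC subrK.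
by apply: le_trans; rewrite ler_wpDl.
Qed.

Let sqrt_bounds r : 0 <= r < 1 -> 0 <= Num.sqrt r < 1.
Proof. by move=> /andP[r0 r1]; rewrite sqrtr_ge0 -sqrtr1 ltr_sqrt. Qed.

(** Write r = s^2: in n r^n = (n s^n) s^n the first factor is bounded and the second tends to 0. *)
Lemma mulrn_expr_small r e : 0 <= r < 1 -> 0 < e ->
  exists N, forall n, (N <= n)%N -> n%:R * r ^+ n < e.
Proof.
move=> r01 e0; have s01 := sqrt_bounds r01.
have [B B0 sB] := mulrn_expr_bounded s01.
have [N sN] := expr_small B s01 e0; exists N => n /sN; apply: le_lt_trans.
have /andP[r0 _] := r01; rewrite -{1}(sqr_sqrtr r0) -exprM mulnC exprM expr2.
by rewrite mulrA mulrC ler_wpM2l ?exprn_ge0 ?sqrtr_ge0.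
Qed.

Lemma sqr_mulrn_expr_bounded r : 0 <= r < 1 ->
  exists2 B, 0 <= B & forall n, n%:R ^+ 2 * r ^+ n <= B.
Proof.
move=> r01; have s01 := sqrt_bounds r01; have [B B0 sB] := mulrn_expr_bounded s01.
exists (B ^+ 2) => [|n]; first by rewrite exprn_ge0.
have /andP[r0 _] := r01; rewrite -{1}(sqr_sqrtr r0) -exprM mulnC exprM -exprMn.
by rewrite lerXn2r ?nnegrE // mulr_ge0 // exprn_ge0 ?sqrtr_ge0.
Qed.

End GeometricDecay.

(** * The p-adic logarithm of a power, and powers of q different from 1 *)

Section PadicLog.
Variables (R : realType) (p : nat) (C : padicComplex R p).
Hypothesis p_prime : prime p.
Implicit Types x : C.

Lemma absCp_nonarch : nonarch_abs (@absCp R p C).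
Proof. exact: completion_abs (Cp_completion C). Qed.

Let absM := nonarch_absM absCp_nonarch.
Let abs_ge0 := nonarch_abs_ge0 absCp_nonarch.
Let absX := nonarch_absX absCp_nonarch.
Let absV := nonarch_absV absCp_nonarch.
Let absN := nonarch_absN absCp_nonarch.
Let abs_nat := nonarch_abs_nat absCp_nonarch.
Hint Resolve abs_ge0 abs_nat : core.

Lemma absCp_natr k : (0 < k)%N -> absCp (k%:R : C) = (p ^ logn p k)%:R^-1.
Proof.
move=> k0.
have -> : (k%:R : C) = Qpbar_to_Cp C (Qp_to_Qpbar C (rat_to_Qp C k%:R)).
  by rewrite !rmorph_nat.
rewrite (completion_isometry (Cp_completion C)) Qpbar_abs_extends.
rewrite (completion_isometry (Qp_completion C)) /padic_abs pnatr_eq0.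
rewrite (negPf (lt0n_neq0 k0)) (pmulrn (1 : rat)) denq_int numq_int /= logn1 sub0r.
by rewrite -invr_expz -exprnP natrX.
Qed.

Lemma absCp_pX N : absCp ((p ^ N)%:R : C) = p%:R^-1 ^+ N.
Proof.
by rewrite absCp_natr ?expn_gt0 ?prime_gt0 // pfactorK // natrX exprVn.
Qed.

Lemma invp_bounds : 0 <= (p%:R^-1 : R) < 1.
Proof.
by rewrite invr_ge0 ler0n invf_lt1 ?ltr0n ?prime_gt0 // ltr1n prime_gt1.
Qed.

(** For k > 0 the left side is the exact power of p dividing k. At k = 0 both sides are 0, since
    0^-1 = 0. *)
Lemma absCp_invn k : absCp (k%:R^-1 : C) <= k%:R.
Proof.
rewrite absV; case: k => [|k].
  by rewrite (nonarch_abs0 absCp_nonarch) invr0.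
rewrite absCp_natr // invrK ler_nat dvdn_leq //; exact: pfactor_dvdnn.
Qed.

(** The k-th term has size at most k |x - 1|^k, which tends to 0. So a limit exists, and [xget]
    returns it rather than the default 0. *)
Lemma padic_log_cvg x : absCp (x - 1) < 1 -> vcvg (@absCp R p C)
  (fun n => \sum_(1 <= k < n) (-1) ^+ k.+1 * (x - 1) ^+ k / k%:R) (padic_log x).
Proof.
move=> x1; rewrite /padic_log; apply: xgetPex.
apply: (vcomplete_series absCp_nonarch).
  exact: completion_complete (Cp_completion C).
apply/(vcvgP absCp_nonarch) => e e0.
have x01 : 0 <= absCp (x - 1) < 1 by rewrite abs_ge0.
have [N xN] := mulrn_expr_small x01 e0; exists N => n /xN; apply: le_lt_trans.
rewrite subr0 !absM !absX absN (nonarch_abs1 absCp_nonarch) expr1n mul1r.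
by rewrite mulrC ler_wpM2r ?exprn_ge0 // absCp_invn.
Qed.

(* C(M, k) + C(M, k+1) = C(M+1, k+1) = (M+1)/(k+1) C(M, k), so modulo M+1 the
   binomials C(M, k) alternate in sign, up to the denominators k. *)
Lemma absCp_bin_sub_sign M k :
  absCp ('C(M, k)%:R - (-1) ^+ k : C) <= absCp (M.+1%:R : C) * k%:R.
Proof.
elim: k => [|k IHk].
  by rewrite bin0 subrr (nonarch_abs0 absCp_nonarch) mulr0.
have -> : ('C(M, k.+1)%:R - (-1) ^+ k.+1 : C) =
    'C(M.+1, k.+1)%:R - ('C(M, k)%:R - (-1) ^+ k).
  by rewrite binS natrD exprS; ring.
apply: (nonarch_absD_le absCp_nonarch); last first.
  by rewrite absN (le_trans IHk) // ler_wpM2l // ler_nat.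
have k0 : (k.+1%:R : C) != 0 by exact: Cp_natr_neq0.
have -> : ('C(M.+1, k.+1)%:R : C) = M.+1%:R * ('C(M, k)%:R * k.+1%:R^-1).
  by rewrite mulrA -natrM (mul_bin_diag M.+1 k) natrM mulrAC divff ?mul1r.
by rewrite absM ler_wpM2l // absM (le_trans _ (absCp_invn _)) // ler_piMl.
Qed.

(** Put y = x - 1 and expand (1 + y)^(M+1). Since C(M+1, i+1) / (M+1) = C(M, i) / (i+1), the
    difference is the sum over i <= M of (C(M, i) - (-1)^i) y^(i+1) / (i+1). The sign defect costs
    |M+1| i and the denominator at most i+1, whence the bound on k^2 |y|^k. *)
Lemma padic_log_approx x (B : R) M :
  (forall k, k%:R ^+ 2 * absCp (x - 1) ^+ k <= B) -> 0 <= B ->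
  absCp ((x ^+ M.+1 - 1) / M.+1%:R
    - \sum_(1 <= k < M.+2) (-1) ^+ k.+1 * (x - 1) ^+ k / k%:R)
  <= absCp (M.+1%:R : C) * B.
Proof.
set y := x - 1 => yB B0; have -> : x = 1 + y by rewrite addrC subrK.
rewrite exprDn big_ord_recl /= expr1n expr0 mulr1 bin0 addrAC subrr add0r.
rewrite big_add1 /= big_mkord mulr_suml -sumrB.
apply: (nonarch_abs_sum_le absCp_nonarch) => [|i _]; first exact: mulr_ge0.
have -> : 1 ^+ (M.+1 - bump 0 i) * y ^+ bump 0 i *+ 'C(M.+1, bump 0 i) / M.+1%:R
    - (-1) ^+ i.+2 * y ^+ i.+1 / i.+1%:R =
    ('C(M, i)%:R - (-1) ^+ i) * (i.+1%:R^-1 * y ^+ i.+1).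
  have [i0 M0] : (i.+1%:R : C) != 0 /\ (M.+1%:R : C) != 0.
    by split; apply: Cp_natr_neq0.
  rewrite expr1n mul1r /bump add1n -mulr_natl mulrBl; congr (_ - _); last first.
    by rewrite 2!(exprS (-1)) !mulN1r opprK -mulrA [y ^+ _ / _]mulrC.
  rewrite mulrA mulrAC; congr (_ * _); apply/eqP.
  by rewrite eqr_div // -!natrM mulnC -mul_bin_diag mulnC.
rewrite !absM absX (le_trans _ (ler_wpM2l (abs_ge0 _) (yB i.+1))) //.
rewrite mulrA [leRHS]mulrA ler_wpM2r ?exprn_ge0 // expr2 mulrA.
apply: ler_pM => //; last exact: absCp_invn.
rewrite (le_trans (absCp_bin_sub_sign M i)) // ler_wpM2l // ler_nat.
exact: leqnSn.
Qed.

Lemma padic_log_limit x : absCp (x - 1) < 1 ->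
  vcvg (@absCp R p C) (fun N => (x ^+ (p ^ N) - 1) / (p ^ N)%:R) (padic_log x).
Proof.
move=> x1; have x01 : 0 <= absCp (x - 1) < 1 by rewrite abs_ge0.
(* The partial sums run over k < n, so index p^N + 1 is the one that ends at k = p^N, the degree of
   the binomial expansion. *)
have le_pN N : (N <= (p ^ N).+1)%N by rewrite ltnW // ltnW // ltnS ltn_expl // prime_gt1.
apply: (vcvg_sub0 absCp_nonarch (vcvg_subseq absCp_nonarch le_pN (padic_log_cvg x1))).
have [B B0 xB] := sqr_mulrn_expr_bounded x01.
apply/(vcvgP absCp_nonarch) => e e0.
have [N BN] := expr_small B invp_bounds e0; exists N => n /BN.
apply: le_lt_trans; rewrite subr0 /= -absCp_pX.
have : (0 < p ^ n)%N by rewrite expn_gt0 prime_gt0.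
by case: (p ^ n)%N => // M _; apply: padic_log_approx.
Qed.

(** With P = p^n and L = (x^P - 1) / P, one has (x^(wP) - 1) / P = L S, where S is the sum of x^(Pi)
    over i < w. Here L tends to log x, and S tends to w because |x^(Pi) - 1| <= |x^P - 1| = |P|
    |L|. *)
Lemma padic_logX x w : absCp (x - 1) < 1 -> padic_log (x ^+ w) = w%:R * padic_log x.
Proof.
move=> x1; have xw1 : absCp (x ^+ w - 1) < 1.
  by rewrite (le_lt_trans (nonarch_absX_sub1 absCp_nonarch _ _)) // ltW.
apply: (vcvg_unique absCp_nonarch (padic_log_limit xw1)).
have /(vcvgP absCp_nonarch) xl := padic_log_limit x1.
apply/(vcvgP absCp_nonarch) => e e0.
(* Once |L - log x| < 1, the ultrametric inequality bounds |L| by this maximum; the error L (S - w)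
   is then at most |P| B^2. *)
pose B := Num.max (absCp (padic_log x)) 1.
have B1 : 1 <= B by rewrite le_max lexx orbT.
have B0 : 0 <= B by rewrite (le_trans ler01).
have [N1 xN1] := xl _ ltr01; have [N2 xN2] := xl _ e0.
have [N3 BN] := expr_small (B * B) invp_bounds e0.
exists (maxn N1 (maxn N2 N3)) => n.
rewrite !geq_max => /and3P[/xN1 xn1 /xN2 xn2 /BN]; rewrite -absCp_pX.
set P := (p ^ n)%N in xn1 xn2 *; set L := (x ^+ P - 1) / P%:R in xn1 xn2 *.
have P0 : (P%:R : C) != 0 by rewrite Cp_natr_neq0 // expn_gt0 prime_gt0.
have xP : x ^+ P - 1 = P%:R * L by rewrite mulrC divfK.
have LB : absCp L <= B.
  rewrite -(subrK (padic_log x) L) (nonarch_absD_le absCp_nonarch) //.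
    by rewrite (le_trans (ltW xn1)).
  by rewrite le_max lexx.
rewrite exprAC subrX1 xP => Be; set S := \sum_(i < w) _.
have -> : P%:R * L * S / P%:R - w%:R * padic_log x =
    L * (S - w%:R) + w%:R * (L - padic_log x).
  by field.
apply: (nonarch_absD_lt absCp_nonarch); last first.
  by rewrite absM (le_lt_trans _ xn2) // ler_piMl.
apply: le_lt_trans Be; rewrite absM mulrCA; apply: ler_pM => //.
have -> : S - w%:R = \sum_(i < w) ((x ^+ P) ^+ i - 1).
  by rewrite sumrB sumr_const card_ord.
apply: (nonarch_abs_sum_le absCp_nonarch) => [|i _]; first exact: mulr_ge0.
have xP1 : absCp (x ^+ P - 1) <= absCp (x - 1).
  by rewrite (nonarch_absX_sub1 absCp_nonarch) // ltW.
rewrite (le_trans (nonarch_absX_sub1 absCp_nonarch _ _)) //.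
  by rewrite (le_trans xP1) // ltW.
by rewrite xP absM ler_wpM2l.
Qed.

(** If e is the valuation of k+1, then k >= p^e - 1 = (p-1)(1 + p + ... + p^(e-1)) >= (p-1) e. *)
Lemma pred_mul_logn_le k : (p.-1 * logn p k.+1 <= k)%N.
Proof.
have lepk : (p ^ logn p k.+1 <= k.+1)%N by rewrite dvdn_leq // pfactor_dvdnn.
rewrite -ltnS (leq_trans _ lepk) //.
rewrite -[X in (_ < X)%N](@prednK _) ?expn_gt0 ?prime_gt0 // ltnS predn_exp.
rewrite leq_mul2l -{1}[logn p k.+1]card_ord -sum1_card leq_sum ?orbT // => i _.
by rewrite expn_gt0 prime_gt0.
Qed.

Lemma absCp_natr_gt (r : R) k : 0 <= r -> r ^+ p.-1 < p%:R^-1 -> (0 < k)%N ->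
  r ^+ k < absCp (k.+1%:R : C).
Proof.
move=> r0 rp k0; have p10 : (0 < p.-1)%N by rewrite -subn1 subn_gt0 prime_gt1.
have r1 : r < 1.
  have /andP[_ p1] := invp_bounds.
  by rewrite -(@expr_lt1 _ p.-1) // (lt_trans rp).
rewrite absCp_natr //; have := pred_mul_logn_le k.
(* Valuation 0 needs only r^k < 1, where k > 0 enters. For a positive valuation e, r^k <=
   (r^(p-1))^e < p^(-e). *)
case: (logn p k.+1) => [_|e lek]; first by rewrite expn0 invr1 exprn_ilt1 // -lt0n.
rewrite natrX -exprVn (@le_lt_trans _ _ ((r ^+ p.-1) ^+ e.+1)) //.
  by rewrite -exprM ler_wiXn2l // ltW.
by rewrite ltrXn2r // ?exprn_ge0 // invr_ge0.
Qed.

(** Factor y = x - 1 out of (1 + y)^w - 1: the cofactor is w plus terms C(w, j+1) y^j with j > 0. As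
    C(w, j+1) = w C(w-1, j) / (j+1) and |y^j| < |j+1|, all of these are smaller than |w|, so they
    cannot cancel w. *)
Lemma expr_neq1_near1 x w : x != 1 -> absCp (x - 1) ^+ p.-1 < p%:R^-1 ->
  (0 < w)%N -> x ^+ w != 1.
Proof.
case: w => // w x1 xp _; rewrite -subr_eq0; set y := x - 1 in xp *.
have -> : x = 1 + y by rewrite addrC subrK.
rewrite exprDn big_ord_recl /= expr1n expr0 mulr1 bin0 addrAC subrr add0r.
have -> : \sum_(i < w.+1) 1 ^+ (w.+1 - bump 0 i) * y ^+ bump 0 i
      *+ 'C(w.+1, bump 0 i) =
    y * (w.+1%:R + \sum_(i < w) y ^+ i.+1 * 'C(w.+1, i.+2)%:R).
  rewrite big_ord_recl /= expr1n mul1r expr1 bin1 mulrDr mulr_natr mulr_sumr.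
  congr (_ + _); apply: eq_bigr => i _.
  by rewrite expr1n mul1r /bump !add1n -mulr_natr exprS mulrA.
set S := \sum_(i < w) _; apply: mulf_neq0; first by rewrite subr_eq0.
have w0 : 0 < absCp (w.+1%:R : C).
  by rewrite (nonarch_abs_gt0 absCp_nonarch) // Cp_natr_neq0.
suff : absCp S < absCp (w.+1%:R : C).
  by apply: contraTN => /eqP/eqP; rewrite addr_eq0 => /eqP->; rewrite absN ltxx.
apply: (nonarch_abs_sum_lt absCp_nonarch) => // i _.
have i0 : (i.+2%:R : C) != 0 by exact: Cp_natr_neq0.
have -> : ('C(w.+1, i.+2)%:R : C) = w.+1%:R * ('C(w, i.+1)%:R / i.+2%:R).
  by rewrite mulrA -natrM (mul_bin_diag w.+1 i.+1) natrM mulrAC divff ?mul1r.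
rewrite absM absX absM mulrCA gtr_pMr // absM mulrA absV.
rewrite ltr_pdivrMr ?mul1r; last by rewrite (nonarch_abs_gt0 absCp_nonarch).
rewrite (le_lt_trans _ (absCp_natr_gt (abs_ge0 y) xp (ltn0Sn i))) //.
by rewrite ler_piMr ?exprn_ge0.
Qed.

End PadicLog.

(** * Algebra of formal power series and exponential series *)

Section FormalPowerSeriesAlgebra.
Variable K : fieldType.
Implicit Types (f g h : nat -> K) (c x : K).

(** Truncation to polynomials lets the product inherit commutativity and associativity from the
    polynomial ring. *)
Lemma coef_fps_mul f g N i : (i < N)%N ->
  (\poly_(j < N) f j * \poly_(j < N) g j)`_i = fps_mul f g i.
Proof.
move=> iN; rewrite coefM; apply: eq_bigr => j _; rewrite !coef_poly.
have ji : (j <= i)%N by rewrite -ltnS.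
by rewrite (leq_ltn_trans ji iN) (leq_ltn_trans (leq_subr _ _) iN).
Qed.

Lemma fps_mulC : commutative (@fps_mul K).
Proof.
move=> f g; apply/funext => n.
by rewrite -!(@coef_fps_mul _ _ n.+1) // mulrC.
Qed.

Lemma fps_mulA : associative (@fps_mul K).
Proof.
have fpsE f g h n : fps_mul (fps_mul f g) h n =
    (\poly_(j < n.+1) f j * \poly_(j < n.+1) g j * \poly_(j < n.+1) h j)`_n.
  rewrite coefM; apply: eq_bigr => j _.
  by rewrite coef_fps_mul // coef_poly ltnS leq_subr.
move=> f g h; apply/funext => n.
by rewrite fps_mulC !fpsE [in LHS]mulrC mulrA.
Qed.

Lemma fps_mulACA : interchange (@fps_mul K) (@fps_mul K).
Proof.
move=> f g h k; rewrite -!fps_mulA; congr fps_mul.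
by rewrite !fps_mulA [fps_mul g h]fps_mulC.
Qed.

Lemma fps_mul1 f : fps_mul f (fun n => (n == 0)%N%:R) = f.
Proof.
apply/funext => n; rewrite /fps_mul big_ord_recr /= subnn mulr1 big1 ?add0r //.
by move=> i _; rewrite subn_eq0 leqNgt ltn_ord mulr0.
Qed.

Lemma fps_mulI h f g : h 0%N != 0 -> fps_mul f h = fps_mul g h -> f = g.
Proof.
move=> h0 eq_fg; rewrite -(fps_mul1 f) -(fps_mul1 g).
have <- : fps_mul h (fps_inv h) = (fun n => (n == 0)%N%:R).
  by apply/funext => n; rewrite fps_mulC fps_mulVf.
by rewrite !fps_mulA eq_fg.
Qed.

Lemma fps_mul0 f g : fps_mul f g 0%N = f 0%N * g 0%N.
Proof. by rewrite /fps_mul big_ord1. Qed.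

Lemma fps_mulBr f g h :
  fps_mul f (fun n => g n - h n) = (fun n => fps_mul f g n - fps_mul f h n).
Proof.
apply/funext => n; rewrite /fps_mul -sumrB; apply: eq_bigr => i _.
by rewrite mulrBr.
Qed.

Lemma fps_mulZl c f g :
  fps_mul (fun n => c * f n) g = (fun n => c * fps_mul f g n).
Proof.
apply/funext => n; rewrite /fps_mul mulr_sumr.
by apply: eq_bigr => i _; rewrite mulrA.
Qed.

Lemma fps_mul_suml N (F : nat -> nat -> K) g n :
  fps_mul (fun k => \sum_(i < N) F i k) g n = \sum_(i < N) fps_mul (F i) g n.
Proof.
by rewrite /fps_mul exchange_big; apply: eq_bigr => j _; rewrite mulr_suml.
Qed.

(* The substitution t |-> c t. *)
Definition fps_dilate c f (n : nat) : K := c ^+ n * f n.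

Lemma fps_dilateM c f g :
  fps_dilate c (fps_mul f g) = fps_mul (fps_dilate c f) (fps_dilate c g).
Proof.
apply/funext => n; rewrite /fps_dilate /fps_mul mulr_sumr.
apply: eq_bigr => i _; have {1}<- : (i + (n - i) = n)%N.
  by rewrite subnKC // -ltnS.
by rewrite exprD mulrACA.
Qed.

Lemma fps_dilate_exp c x : fps_dilate c (fps_exp x) = fps_exp (c * x).
Proof. by apply/funext => n; rewrite /fps_dilate /fps_exp mulrA exprMn. Qed.

(** Each l <= n leaves the single index m = n - l, and l > n leaves none. The bound [N] is kept
    apart from [n] because [sum3_antidiagonal] uses degree n - k with ranges still up to n. *)
Lemma sum_antidiagonal f g N n : (n <= N)%N ->
  \sum_(l < N.+1) \sum_(m < N.+1 | (l + m == n)%N) f l * g m = fps_mul f g n.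
Proof.
move=> nN; rewrite /fps_mul (big_ord_widen N.+1 (fun i => f i * g (n - i)%N)) //.
rewrite [RHS]big_mkcond /=; apply: eq_bigr => l _; rewrite ltnS.
case: leqP => [ln|nl]; last first.
  by rewrite big1 // => m /eqP lm; move: nl; rewrite -lm ltnNge leq_addr.
have nlN : (n - l < N.+1)%N by rewrite ltnS (leq_trans (leq_subr _ _)).
rewrite (big_pred1 (Ordinal nlN)) // => m /=.
by rewrite -val_eqE /= -[RHS](eqn_add2l l) subnKC.
Qed.

Lemma sum3_antidiagonal f g h n :
  \sum_(k < n.+1) \sum_(l < n.+1) \sum_(m < n.+1 | (k + l + m == n)%N)
    f k * g l * h m = fps_mul f (fps_mul g h) n.
Proof.
apply: eq_bigr => k _; have kn : (k <= n)%N by rewrite -ltnS.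
rewrite -(sum_antidiagonal _ _ (leq_subr k n)) mulr_sumr; apply: eq_bigr => l _.
rewrite mulr_sumr; apply: eq_big => [m|m _]; last by rewrite mulrA.
by rewrite -[RHS](eqn_add2l k) subnKC // addnA.
Qed.

Hypothesis K0 : forall n, (0 < n)%N -> (n%:R : K) != 0.

Lemma fps_expD x y : fps_mul (fps_exp x) (fps_exp y) = fps_exp (x + y).
Proof.
apply/funext => n; rewrite /fps_mul /fps_exp addrC exprDn mulr_suml.
apply: eq_bigr => i _; have ni : (i <= n)%N by rewrite -ltnS.
have [f0 g0 h0] : [/\ (i`!%:R : K) != 0, ((n - i)`!%:R : K) != 0 &
    (n`!%:R : K) != 0] by split; apply: K0; rewrite fact_gt0.
rewrite mulf_div -(mulr_natr _ 'C(n, i)) [x ^+ _ * _]mulrC -[RHS]mulrA; congr (_ * _).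
apply: (canRL (mulfK h0)); rewrite -(bin_fact ni) !natrM mulrC.
by rewrite mulfK // mulf_neq0.
Qed.

(* x^a e^(at) - 1 *)
Definition qexp_sub1 x (a : nat) : nat -> K :=
  fun n => x ^+ a * fps_exp a%:R n - (n == 0)%N%:R.

Lemma qexp_sub1_0 x a : qexp_sub1 x a 0%N = x ^+ a - 1.
Proof. by rewrite /qexp_sub1 /fps_exp expr0 divff ?mulr1 ?oner_neq0. Qed.

Lemma qexp_sub1_dilate x a b :
  fps_dilate b%:R (qexp_sub1 (x ^+ b) a) = qexp_sub1 x (b * a).
Proof.
apply/funext => n; rewrite /fps_dilate /qexp_sub1 mulrBr mulrCA -exprM.
rewrite -/(fps_dilate _ _ _) fps_dilate_exp -natrM; congr (_ - _).
by case: n => [|n]; rewrite ?mul1r ?mulr0.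
Qed.

(** Multiplication by x^a e^(at) - 1 makes the sum telescope: the term i = N survives, and the term
    i = 0 is the constant series 1. *)
Lemma qexp_geometric x a N :
  fps_mul (fun l => \sum_(i < N) x ^+ (a * i) * fps_exp (a * i)%:R l)
    (qexp_sub1 x a) = qexp_sub1 x (a * N).
Proof.
apply/funext => n.
rewrite (fps_mul_suml _ (fun i l => x ^+ (a * i) * fps_exp (a * i)%:R l)).
under eq_bigr => i _.
  rewrite /qexp_sub1 fps_mulBr fps_mul1 fps_mulC !fps_mulZl fps_mulC fps_mulZl.
  rewrite fps_expD mulrA -exprD -natrD [(a + _)%N]addnC -mulnSr.
  over.
rewrite /= -(big_mkord xpredT (fun i => x ^+ (a * i.+1) * fps_exp (a * i.+1)%:R n
  - x ^+ (a * i) * fps_exp (a * i)%:R n)).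
rewrite (telescope_sumr (fun i => x ^+ (a * i) * fps_exp (a * i)%:R n)) //.
rewrite muln0 expr0 mul1r /qexp_sub1; congr (_ - _).
by case: n => [|n]; rewrite /fps_exp ?expr0 ?divff ?oner_neq0 // expr0n mul0r.
Qed.

End FormalPowerSeriesAlgebra.

(** * Generating functions of the triple sums and their cyclic invariance *)

Section GeneratingFunctions.
Variables (R : realType) (p : nat) (C : padicComplex R p).
Hypothesis p_prime : prime p.
Implicit Types q x : C.

Definition log_addX q : nat -> C :=
  fun n => if n is 0%N then padic_log q else (n == 1)%N%:R.

Lemma qBern_gfE q : q != 1 -> fps_mul (qBern_gf q) (qexp_sub1 q 1) = log_addX q.
Proof.
move=> q1; rewrite /qBern_gf -/(log_addX q) -/(qexp_sub1 q 1) -fps_mulA.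
rewrite (_ : fps_mul (fps_inv _) _ = fun n => (n == 0)%N%:R) ?fps_mul1 //.
by apply/funext => n; rewrite fps_mulVf // qexp_sub1_0 expr1 subr_eq0.
Qed.

(** This is log(q^a) + at = a (log q + t), the place where the logarithm of a power enters. *)
Lemma log_addX_dilate q a : absCp (q - 1) < 1 ->
  fps_dilate a%:R (log_addX (q ^+ a)) = (fun n => a%:R * log_addX q n).
Proof.
move=> q1; apply/funext => -[|[|n]]; rewrite /fps_dilate /=.
- by rewrite mul1r padic_logX.
- by rewrite expr1.
- by rewrite !mulr0.
Qed.

Lemma qBern_poly_gf q x a : absCp (q - 1) < 1 -> q ^+ a != 1 ->
  fps_mul (fps_dilate a%:R (fps_mul (qBern_gf (q ^+ a)) (fps_exp x)))
    (qexp_sub1 q a) =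
  (fun n => a%:R * fps_mul (log_addX q) (fps_exp (a%:R * x)) n).
Proof.
(* Reading a as a * 1 exhibits q^a e^(at) - 1 as the denominator Q e^t - 1 for Q = q^a, taken at
   at. *)
move=> q1 qa1; rewrite -{3}[a]muln1 -qexp_sub1_dilate -fps_dilateM.
rewrite [fps_mul _ (fps_exp x)]fps_mulC -fps_mulA qBern_gfE // fps_dilateM.
by rewrite fps_dilate_exp log_addX_dilate // fps_mulC fps_mulZl.
Qed.

Definition qpow_sum_gf q (b u : nat) : nat -> C :=
  fps_dilate b%:R (fun l => qpow_sum l (q ^+ b) u.-1 / l`!%:R).

Lemma qpow_sum_gfE q b u : (0 < u)%N ->
  fps_mul (qpow_sum_gf q b u) (qexp_sub1 q b) = qexp_sub1 q (b * u).
Proof.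
move=> u0; rewrite -(qexp_geometric (@Cp_natr_neq0 R p C)); congr fps_mul.
apply/funext => l; rewrite /qpow_sum_gf /fps_dilate /qpow_sum prednK // mulr_suml mulr_sumr.
apply: eq_bigr => i _; rewrite /fps_exp natrM exprMn -exprM.
by rewrite mulrA mulrA mulrCA mulrA.
Qed.

(** The three dilations contribute (u2 u3)^k (u1 u3)^l (u1 u2)^m = u1^(l+m) u2^(k+m) u3^(k+l); the
    scalar in front supplies the two exponents -1. *)
Definition triple_gf q (y : C) (u1 u2 u3 : nat) : nat -> C :=
  fun n => (u2 * u3)%:R^-1 * fps_mul
    (fps_dilate (u2 * u3)%:R
      (fps_mul (qBern_gf (q ^+ (u2 * u3))) (fps_exp (u1%:R * y))))
    (fps_mul (qpow_sum_gf q (u1 * u3) u2) (qpow_sum_gf q (u1 * u2) u3)) n.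

Lemma triple_gf_mul q y u1 u2 u3 : absCp (q - 1) < 1 ->
  (forall w, (0 < w)%N -> q ^+ w != 1) ->
  (0 < u1)%N -> (0 < u2)%N -> (0 < u3)%N ->
  fps_mul (triple_gf q y u1 u2 u3)
    (fps_mul (qexp_sub1 q (u2 * u3))
      (fps_mul (qexp_sub1 q (u1 * u3)) (qexp_sub1 q (u1 * u2)))) =
  fps_mul (fps_mul (log_addX q) (fps_exp ((u1 * u2 * u3)%:R * y)))
    (fps_mul (qexp_sub1 q (u1 * u2 * u3)) (qexp_sub1 q (u1 * u2 * u3))).
Proof.
move=> q1 qX1 u10 u20 u30; rewrite /triple_gf fps_mulZl.
(* Pair each of the three factors with its own denominator. *)
rewrite fps_mulACA [fps_mul (fps_mul (qpow_sum_gf _ _ _) _) _]fps_mulACA.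
have a0 : (0 < u2 * u3)%N by rewrite muln_gt0 u20.
rewrite qBern_poly_gf ?qX1 // !qpow_sum_gfE // fps_mulZl.
apply/funext => n; rewrite mulrA mulVf ?Cp_natr_neq0 // mul1r.
by rewrite mulrA -natrM mulnC mulnA [(u1 * u3 * u2)%N]mulnAC.
Qed.

Lemma triple_sumE q y u1 u2 u3 n : (0 < u2)%N -> (0 < u3)%N ->
  \sum_(k < n.+1) \sum_(l < n.+1) \sum_(m < n.+1 | (k + l + m == n)%N)
      trinom C n k l m
      * qBern_poly k (q ^+ (u2 * u3)) (u1%:R * y)
      * qpow_sum l (q ^+ (u1 * u3)) u2.-1
      * qpow_sum m (q ^+ (u1 * u2)) u3.-1
      * u1%:R ^+ (l + m) * u2%:R ^ ((k + m)%:Z - 1) * u3%:R ^ ((k + l)%:Z - 1)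
  = n`!%:R * triple_gf q y u1 u2 u3 n.
Proof.
move=> u20 u30; rewrite /triple_gf -sum3_antidiagonal !mulr_sumr.
apply: eq_bigr => k _; rewrite !mulr_sumr; apply: eq_bigr => l _.
rewrite !mulr_sumr; apply: eq_bigr => m _.
rewrite /trinom /qBern_poly /qpow_sum_gf /fps_dilate !natrM !exprMn !exprD.
have [u2n0 u3n0] : (u2%:R : C) != 0 /\ (u3%:R : C) != 0.
  by split; apply: Cp_natr_neq0.
have [k0 l0 m0] : [/\ (k`!%:R : C) != 0, (l`!%:R : C) != 0 & (m`!%:R : C) != 0].
  by split; apply: Cp_natr_neq0; rewrite fact_gt0.
(* The exponents k+m-1 and k+l-1 can be -1, so they are integers; splitting off the inverse uses
   that u2 and u3 are nonzero in C. *)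
rewrite !expfzDr // -!exprnP !exprD -!invr_expz !expr1z.
move: (qpow_sum l _ _) (qpow_sum m _ _) (fps_mul _ _ k) => Sl Sm Bk.
by field; rewrite u2n0 u3n0 k0 l0 m0.
Qed.

Lemma triple_gf_cycle q y u1 u2 u3 : absCp (q - 1) < 1 ->
  (forall w, (0 < w)%N -> q ^+ w != 1) ->
  (0 < u1)%N -> (0 < u2)%N -> (0 < u3)%N ->
  triple_gf q y u1 u2 u3 = triple_gf q y u2 u3 u1.
Proof.
move=> q1 qX1 u10 u20 u30.
apply: (fps_mulI (h := fps_mul (qexp_sub1 q (u2 * u3))
  (fps_mul (qexp_sub1 q (u1 * u3)) (qexp_sub1 q (u1 * u2))))).
  by rewrite !fps_mul0 !qexp_sub1_0 !mulf_neq0 // subr_eq0 qX1 // muln_gt0 ?u10 ?u20.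
rewrite triple_gf_mul // (mulnC u1 u3) (mulnC u1 u2).
(* The cycle (u2, u3, u1) has the same three denominators with this one in last place. *)
set D := qexp_sub1 q (u2 * u3).
rewrite [fps_mul D _]fps_mulC -[fps_mul (fps_mul _ _) D]fps_mulA.
by rewrite triple_gf_mul // (mulnAC u2 u1 u3).
Qed.

End GeneratingFunctions.

Theorem theorem4p8 (R : realType) (p : nat) (p_prime : prime p)
    (C : padicComplex R p) (q : C) (q_neq1 : q != 1)
    (q_near1 : absCp (q - 1) < p%:R `^ (- (p.-1)%:R^-1))
    (w1 w2 w3 : nat) (w1_gt0 : (0 < w1)%N) (w2_gt0 : (0 < w2)%N)
    (w3_gt0 : (0 < w3)%N) (n : nat) (y1 : Qp C) (y1_int : padicInt C y1) :
  let T (u1 u2 u3 : nat) : C :=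
    \sum_(k < n.+1) \sum_(l < n.+1) \sum_(m < n.+1 | (k + l + m == n)%N)
      trinom C n k l m
      * qBern_poly k (q ^+ (u2 * u3)) (u1%:R * Qp_to_Cp y1)
      * qpow_sum l (q ^+ (u1 * u3)) u2.-1
      * qpow_sum m (q ^+ (u1 * u2)) u3.-1
      * u1%:R ^+ (l + m) * u2%:R ^ ((k + m)%:Z - 1) * u3%:R ^ ((k + l)%:Z - 1)
  in T w1 w2 w3 = T w2 w3 w1 /\ T w2 w3 w1 = T w3 w1 w2.
Proof.
have p10 : (0 < p.-1)%N by rewrite -subn1 subn_gt0 prime_gt1.
(* Raising to the power p - 1 > 0 replaces the real exponent -1/(p-1) by an inverse of p. *)
have qp : absCp (q - 1) ^+ p.-1 < p%:R^-1.
  have -> : (p%:R^-1 : R) = (p%:R `^ (- (p.-1)%:R^-1)) ^+ p.-1.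
    rewrite -powR_mulrn ?powR_ge0 // -powRrM mulNr mulVf ?pnatr_eq0 -?lt0n //.
    by rewrite powR_inv1.
  by rewrite ltrXn2r -?lt0n ?nnegrE ?powR_ge0 // (nonarch_abs_ge0 (absCp_nonarch C)).
have q1 : absCp (q - 1) < 1.
  rewrite -(@expr_lt1 _ p.-1) // ?(nonarch_abs_ge0 (absCp_nonarch C)) //.
  by apply: lt_trans qp _; case/andP: (invp_bounds R p_prime).
have qX1 w : (0 < w)%N -> q ^+ w != 1 by apply: expr_neq1_near1.
by rewrite /=; split; rewrite !triple_sumE // triple_gf_cycle.
Qed.
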